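(* Let $X$ be a non-degenerate real random variable such that $\varphi(t):=\log \mathbb{E}[e^{tX}]$ is finite for all $t\ge 0$. Let $\{X_{i,j}:(i,j)\in\mathbb{N}^2\}$ be independent copies of $X$, let $\{N_n\}_{n\in\mathbb{N}}$ be a sequence of natural numbers with $\lim_{n\to\infty}e^{-cn}N_n=1$ for some $c>0$, and let $Z_n=\sum_{i=1}^{N_n}\prod_{j=1}^n e^{X_{i,j}}$. Let $c_1:=\varphi'(1)-\varphi(1)$. Then, as $n\to\infty$, in probability, $$\frac1n\log Z_n\to\begin{cases}\varphi(1)+c, & \text{if } c\in[c_1,\infty),\\ I^{-1}(c), & \text{if } c\in(0,c_1],\end{cases}$$ where $I^{-1}$ denotes the inverse function of $I$.
   Context: Non-degenerate means not almost surely constant. Under the hypothesis on $\varphi$, $\varphi$ is infinitely differentiable and strictly convex on $(0,\infty)$. Let $\beta_0:=\lim_{t\to0+}\varphi'(t)=\mathbb{E}X$ and $\beta_\infty:=\lim_{t\to+\infty}\varphi'(t)=\operatorname{ess\,sup}X$ (possibly $\beta_0=-\infty$ or $\beta_\infty=+\infty$). The function $I:(\beta_0,+\infty)\to(0,+\infty]$ is defined by $I(\beta)=\sup_{t\ge0}(\beta t-\varphi(t))$. On $(\beta_0,\beta_\infty)$ it is finite, strictly increasing and strictly convex, and $I^{-1}$ is the inverse of its restriction to this interval. For $\alpha>0$, $I(\varphi'(\alpha))=\alpha\varphi'(\alpha)-\varphi(\alpha)$ is strictly increasing in $\alpha$ and tends to $0$ as $\alpha\to0+$; in particular $c_1=I(\varphi'(1))>0$,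 and $I^{-1}(c)$ is well-defined for $c\in(0,c_1]$. *)

(* Defs.v *)
From HB Require Import structures.
From mathcomp Require Import all_boot all_order all_algebra finmap.
From mathcomp Require Import all_classical all_reals all_analysis.

Set Implicit Arguments.
Unset Strict Implicit.
Unset Printing Implicit Defensive.

Import Order.TTheory GRing.Theory Num.Theory.
Import numFieldNormedType.Exports.

Local Open Scope classical_set_scope.
Local Open Scope ring_scope.

Definition mutually_independent (d : measure_display) (T : measurableType d)
    (R : realType) (P : probability T R) (I : choiceType)
    (X : I -> {RV P >-> R}) : Prop :=
  forall (J : {fset I}) (B : I -> set R),
    (forall i, i \in J -> measurable (B i)) ->
    P (\bigcap_(i in [set` J]) (X i @^-1` B i)) =
    (\prod_(i <- J) P (X i @^-1` B i))%E.

(* A measure is a total function on [set R], unconstrained on nonmeasurable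
   sets; hence the comparison on measurable sets only. *)
Definition same_distribution (d d' : measure_display) (T : measurableType d)
    (T' : measurableType d') (R : realType) (P : probability T R)
    (P' : probability T' R) (X : {RV P >-> R}) (Y : {RV P' >-> R}) : Prop :=
  forall B : set R, measurable B -> distribution P X B = distribution P' Y B.

Definition non_degenerate (d : measure_display) (T : measurableType d)
    (R : realType) (P : probability T R) (X : {RV P >-> R}) : Prop :=
  ~ exists a : R, {ae P, forall w, X w = a}.

(* Intended for measurable [Y n]: [P] is unconstrained on nonmeasurable sets. *)
Definition cvg_in_probability (d : measure_display) (T : measurableType d)
    (R : realType) (P : probability T R) (Y : nat -> T -> R) (l : R) : Prop :=
  forall eps : R, 0 < eps ->
    P [set w | eps < `|Y n w - l|] @[n --> \oo] --> 0%E.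

Section log_mgf.
Context (d : measure_display) (T : measurableType d) (R : realType)
  (P : probability T R) (X : {RV P >-> R}).

Definition log_mgf (t : R) : \bar R := lne (mmt_gen_fun P X t).

(* Real-valued version of [log_mgf], meaningful where the latter is finite. *)
Definition phi (t : R) : R := fine (log_mgf t).

Definition beta_zero : \bar R := lim ((derive1 phi t)%:E @[t --> 0^'+]).

Definition beta_infty : \bar R := lim ((derive1 phi t)%:E @[t --> +oo%R]).

Definition rate (b : R) : \bar R :=
  ereal_sup [set (b * t - phi t)%:E | t in `[0, +oo[].

(* Inverse of the restriction of [rate] to the open interval
   (beta_zero, beta_infty); it takes the default value 0 outside the image. *)
Definition rate_inv (c : R) : R :=
  'pinv_(fun=> 0) [set b | (beta_zero < b%:E < beta_infty)%E] rate c%:E.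

Definition c_one : R := derive1 phi 1 - phi 1.

End log_mgf.

(* Indices are shifted to start from 0: [i < N n] and [j < n]. *)
Definition Z (d : measure_display) (T : measurableType d) (R : realType)
    (P : probability T R) (X : nat * nat -> {RV P >-> R}) (N : nat -> nat)
    (n : nat) (w : T) : R :=
  \sum_(i < N n) \prod_(j < n) expR (X (val i, val j) w).

Arguments mutually_independent {d T R} P {I} X.
Arguments same_distribution {d d' T T' R} P P' X Y.
Arguments non_degenerate {d T R} P X.
Arguments cvg_in_probability {d T R} P Y l.
Arguments log_mgf {d T R} P X t.
Arguments phi {d T R} P X t.
Arguments beta_zero {d T R} P X.
Arguments beta_infty {d T R} P X.
Arguments rate {d T R} P X b.
Arguments rate_inv {d T R} P X c.
Arguments c_one {d T R} P X.
Arguments Z {d T R} P X N n w.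

(* Main.v *)
Require Import Defs.
From HB Require Import structures.
From mathcomp Require Import all_boot all_order all_algebra.
From mathcomp Require Import finmap ring lra.
From mathcomp Require Import all_classical all_reals all_analysis.
From mathcomp Require Import measurable_realfun.
Import Order.TTheory GRing.Theory Num.Theory.
Import numFieldNormedType.Exports.
Local Open Scope classical_set_scope.
Local Open Scope ring_scope.

Set Implicit Arguments.
Unset Strict Implicit.
Unset Printing Implicit Defensive.

(** Put g(t) := t phi'(t) - phi(t) and S_i := X_(i,0) + ... + X_(i,n-1), so that
    Z_n = sum_i exp(S_i) and E exp(t S_i) = exp(n phi(t)). In both regimes there
    is a in (0,1] with g(a) <= c such that the claimed limit l satisfies
    a l = phi(a) + c and l = c - g(a) + phi'(a): a = 1 when c >= c_1, and the
    solution of g(a) = c when c <= c_1.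

    Upper bound: Z^a <= sum_i exp(a S_i) for a <= 1, so Markov's inequality gives
    P(Z >= exp(n (l + eps))) <= N_n exp(n phi(a) - a n (l + eps)) -> 0.

    Lower bound: take b < a close to a, so that g(b) < c. Tilting by exp(b S) and
    Chernoff's bounds give p := P(S_i >= n (phi'(b) - eta)) >=
    exp(- n (g(b) + b eta)) / 2, hence N_n p -> +oo, and by Chebyshev's inequality
    at least N_n p / 2 of the N_n independent rows satisfy
    S_i >= n (phi'(b) - eta). Thus Z_n is at least about
    exp(n (c - g(b) + phi'(b) - 2 eta)), whose rate tends to l as b -> a. *)

Lemma measurable_set_lt (d : measure_display) (T : measurableType d)
    (R : realType) (f : T -> R) (y : R) :
  measurable_fun setT f -> measurable [set w | f w < y].
Proof.
move=> mf; have := mf measurableT _ (measurable_itv `]-oo, y[).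
by rewrite setTI.
Qed.

Lemma measurable_set_ge (d : measure_display) (T : measurableType d)
    (R : realType) (f : T -> R) (y : R) :
  measurable_fun setT f -> measurable [set w | y <= f w].
Proof.
move=> /(@measurable_set_lt _ _ _ _ y)/measurableC; congr measurable.
by apply/seteqP; split => w /=; rewrite leNgt => /negP.
Qed.

(** * Cumulant generating function *)

Section moments.
Context (d : measure_display) (T : measurableType d) (R : realType)
  (P : probability T R) (X : {RV P >-> R}).

(** For [t > 0] this is the [k]-th derivative at [t] of the moment generating function. *)
Definition exp_moment (k : nat) (t : R) : R :=
  (\int[P]_w (X w ^+ k * expR (X w * t)))%R.

Hypothesis mgf_fin : forall t, 0 <= t ->
  P.-integrable setT (fun w => (expR (X w * t))%:E).

Lemma exprn_le_expR (k : nat) (y : R) : 0 <= y -> y ^+ k <= k`!%:R * expR y.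
Proof.
move=> y0; case: k => [|k]; first by rewrite expr0 fact0 mul1r -expR0 ler_expR.
rewrite -ler_pdivrMl ?ltr0n ?fact_gt0// mulrC.
by apply: le_trans (expR_ge1Dxn k y0); rewrite lerDr.
Qed.

Lemma abs_moment_le (k : nat) (t x : R) : 0 < t ->
  `|x| ^+ k * expR (x * t) <= k`!%:R / t ^+ k * (1 + expR (x * (2 * t))).
Proof.
move=> t0.
have h := @exprn_le_expR k (`|x| * t) (mulr_ge0 (normr_ge0 _) (ltW t0)).
have tk : 0 < t ^+ k by rewrite exprn_gt0.
have -> : `|x| ^+ k = (`|x| * t) ^+ k / t ^+ k.
  by rewrite exprMn mulfK// gt_eqF.
rewrite mulrAC [leRHS]mulrAC ler_pM2r ?invr_gt0//.
apply: (le_trans (ler_wpM2r (expR_ge0 _) h)).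
rewrite -mulrA ler_wpM2l// -expRD.
have [x0|x0] := leP 0 x.
  rewrite ger0_norm//; have -> : x * t + x * t = x * (2 * t) by ring.
  by rewrite lerDr.
rewrite ltr0_norm//; have -> : - x * t + x * t = 0 by ring.
by rewrite expR0 lerDl expR_ge0.
Qed.

Lemma integrable_abs_moment (k : nat) (t : R) : 0 < t ->
  P.-integrable setT (fun w => (`|X w| ^+ k * expR (X w * t))%:E).
Proof.
move=> t0.
apply: (@le_integrable _ _ _ P _ measurableT _ (fun w =>
   ((k`!%:R / t ^+ k)%:E * (1 + (expR (X w * (2 * t)))%:E))%E)).
- apply/measurable_EFinP; apply: measurable_funM.
    by apply: measurable_funX; apply: measurableT_comp.
  by apply: measurableT_comp => //; apply: measurable_funM.
- move=> w _; rewrite -EFinD -EFinM !abse_EFin lee_fin.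
  rewrite ger0_norm ?mulr_ge0 ?exprn_ge0 ?expR_ge0//.
  apply: (le_trans (abs_moment_le k (X w) t0)); exact: ler_norm.
- apply: integrableZl => //; apply: integrableD => //.
    by apply: (finite_measure_integrable_cst P 1).
  by apply: mgf_fin; rewrite mulr_ge0// ltW.
Qed.

Lemma integrable_moment (k : nat) (t : R) : 0 < t ->
  P.-integrable setT (fun w => (X w ^+ k * expR (X w * t))%:E).
Proof.
move=> t0; apply: le_integrable (integrable_abs_moment k t0) => //.
- apply/measurable_EFinP; apply: measurable_funM.
    by apply: measurable_funX.
  by apply: measurableT_comp => //; apply: measurable_funM.
- by move=> w _; rewrite !abse_EFin lee_fin !normrM !normrX normr_id.
Qed.

Lemma is_derive_expRM (k : nat) (x t : R) :
  is_derive t 1 (fun s => x ^+ k * expR (x * s)) (x ^+ k.+1 * expR (x * t)).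
Proof.
have h : is_derive t 1 ( *%R x) x.
  by apply: is_derive_eq; rewrite /GRing.scale/= mulr1.
have h2 := @is_derive1_comp _ expR _ _ _ _ (is_derive_expR (x * t)) h.
apply: (is_derive_eq (is_deriveZ (x ^+ k) h2)).
by rewrite /GRing.scale/= exprSr -mulrA [expR _ * x]mulrC.
Qed.

(** Differentiation under the integral sign, on an interval around [t] that stays away from 0, where
    the moments may fail to exist. *)
Lemma is_derive_moment (k : nat) (t : R) : 0 < t ->
  is_derive t 1 (exp_moment k) (exp_moment k.+1 t).
Proof.
move=> t0.
pose f (s : R) (w : T) := X w ^+ k * expR (X w * s).
(* [expR (X w * s)] is monotone in [s], in a direction that depends on the sign of [X w]; the sum of
   its values at both endpoints dominates it in either case. *)
pose G w := `|X w| ^+ k.+1 * expR (X w * (t / 2)) +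
            `|X w| ^+ k.+1 * expR (X w * (t * 2)).
have t20 : 0 < t / 2 by rewrite divr_gt0.
have Ipos s : s \in `]t / 2, t * 2[ -> 0 < s.
  by rewrite in_itv/= => /andP[s1 _]; exact: lt_trans s1.
have It : [set` `]t / 2, t * 2[] t.
  by rewrite /= in_itv/=; apply/andP; split; lra.
have intf s : [set` `]t / 2, t * 2[] s -> P.-integrable setT (EFin \o f s).
  by move=> /Ipos s0; exact: integrable_moment.
have dE s w : partial1of2 f s w = X w ^+ k.+1 * expR (X w * s).
  by rewrite partial1of2E; have [_] := is_derive_expRM k (X w) s.
have df s w : [set` `]t / 2, t * 2[] s -> setT w -> derivable (f ^~ w) s 1.
  by move=> _ _; have [] := is_derive_expRM k (X w) s.
have G0 w : 0 <= G w by rewrite addr_ge0// mulr_ge0 ?exprn_ge0 ?expR_ge0.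
have intG : P.-integrable setT (EFin \o G).
  rewrite /comp/G; under eq_fun do rewrite EFinD.
  by apply: integrableD => //; apply: integrable_abs_moment => //;
     rewrite mulr_gt0.
have Gub s w : [set` `]t / 2, t * 2[] s -> setT w ->
    `|partial1of2 f s w| <= G w.
  move=> sI _; rewrite dE normrM normrX (ger0_norm (expR_ge0 _)) /G -mulrDr.
  rewrite ler_wpM2l ?exprn_ge0//; move: sI; rewrite /= in_itv/= => /andP[s1 s2].
  have [x0|x0] := leP 0 (X w).
    apply: (@le_trans _ _ (expR (X w * (t * 2)))); last by rewrite lerDr expR_ge0.
    by rewrite ler_expR ler_wpM2l// ltW.
  apply: (@le_trans _ _ (expR (X w * (t / 2)))); last by rewrite lerDl expR_ge0.
  by rewrite ler_expR ler_wnM2l// ltW.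
apply: DeriveDef.
  exact: (derivable_under_integral measurableT It intf df G0 intG Gub).
rewrite -derive1E.
rewrite (differentiation_under_integral measurableT It intf df G0 intG Gub).
by apply: eq_Rintegral => w _; rewrite dE.
Qed.

End moments.

(** * The logarithm of the moment generating function: derivatives, strict convexity, behaviour at
    0 *)

Section cumulant.
Context (d : measure_display) (T : measurableType d) (R : realType)
  (P : probability T R) (X : {RV P >-> R}).
Hypothesis log_mgf_fin : forall t : R, 0 <= t -> log_mgf P X t \is a fin_num.

Lemma mgfE (t : R) : mmt_gen_fun P X t = (\int[P]_w (expR (X w * t))%:E)%E.
Proof. by rewrite /mmt_gen_fun unlock. Qed.

Lemma mgf_integrable (t : R) : 0 <= t ->
  P.-integrable setT (fun w => (expR (X w * t))%:E).
Proof.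
move=> /log_mgf_fin h; apply/integrableP; split.
  apply/measurable_EFinP; apply: measurableT_comp => //.
  exact: measurable_funM.
under eq_integral do rewrite abse_EFin ger0_norm ?expR_ge0//.
rewrite -mgfE; move: h; rewrite /log_mgf; case: (mmt_gen_fun P X t) => //= r _.
by rewrite ltry.
Qed.

Lemma mgf_exp_moment (t : R) : 0 <= t ->
  mmt_gen_fun P X t = (exp_moment X 0 t)%:E.
Proof.
move=> t0; rewrite mgfE /exp_moment /Rintegral.
under [in RHS]eq_integral do rewrite expr0 mul1r.
by rewrite fineK// integrable_fin_num//; exact: mgf_integrable.
Qed.

(** Finiteness of [log_mgf] excludes the value 0, at which [lne] is infinite. *)
Lemma exp_moment0_gt0 (t : R) : 0 <= t -> 0 < exp_moment X 0 t.
Proof.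
move=> t0; have := log_mgf_fin t0; rewrite /log_mgf mgf_exp_moment//=.
by case: ifPn => //; rewrite -ltNge.
Qed.

Lemma phiE (t : R) : 0 <= t -> phi P X t = ln (exp_moment X 0 t).
Proof.
move=> t0; rewrite /phi /log_mgf mgf_exp_moment//.
by rewrite lne_EFin//; exact: exp_moment0_gt0.
Qed.

Lemma expR_phi (t : R) : 0 <= t ->
  (\int[P]_w (expR (X w * t))%:E)%E = (expR (phi P X t))%:E.
Proof.
move=> t0; rewrite -mgfE mgf_exp_moment// phiE// lnK//.
by rewrite posrE exp_moment0_gt0.
Qed.

Lemma phi0 : phi P X 0 = 0.
Proof.
apply: expR_inj; apply: EFin_inj; rewrite -expR_phi//.
under eq_integral do rewrite mulr0 expR0.
by rewrite integral_cst//= probability_setT mule1 expR0.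
Qed.

Lemma is_derive_phi (t : R) : 0 < t ->
  is_derive t 1 (phi P X) (exp_moment X 1 t / exp_moment X 0 t).
Proof.
move=> t0; have M0 := exp_moment0_gt0 (ltW t0).
have h : is_derive t 1 (@ln R \o exp_moment X 0)
    (exp_moment X 1 t / exp_moment X 0 t).
  rewrite mulrC; apply: is_derive1_comp; first exact: is_derive1_ln.
  exact: (is_derive_moment mgf_integrable).
(* [phiE] covers nonnegative arguments only, so the derivative is transferred through an equality
   near [t]. *)
apply: near_eq_is_derive h.
near=> s; rewrite phiE//; apply: ltW; near: s; exact: lt_nbhsr.
Unshelve. all: by end_near. Qed.

Lemma derive1_phi (t : R) : 0 < t ->
  derive1 (phi P X) t = exp_moment X 1 t / exp_moment X 0 t.
Proof. by move=> t0; rewrite derive1E; have [_] := is_derive_phi t0. Qed.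

Lemma is_derive_derive1_phi (t : R) : 0 < t ->
  is_derive t 1 (derive1 (phi P X))
    (exp_moment X 2 t / exp_moment X 0 t -
     (exp_moment X 1 t / exp_moment X 0 t) ^+ 2).
Proof.
move=> t0.
have M0 : exp_moment X 0 t != 0 by rewrite gt_eqF// exp_moment0_gt0// ltW.
have h1 := is_derive_moment mgf_integrable 1 t0.
have h0 := is_deriveV M0 (is_derive_moment mgf_integrable 0 t0).
have h : is_derive t 1 (exp_moment X 1 * (fun s => (exp_moment X 0 s)^-1))
    (exp_moment X 2 t / exp_moment X 0 t -
     (exp_moment X 1 t / exp_moment X 0 t) ^+ 2).
  apply: (is_derive_eq (is_deriveM h1 h0)).
  by rewrite /GRing.scale/=; field.
apply: near_eq_is_derive h.
by near=> s; rewrite derive1_phi//; near: s; exact: lt_nbhsr.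
Unshelve. all: by end_near. Qed.

Hypothesis X_nondeg : non_degenerate P X.

(* The second derivative of phi at t is the variance of X under the
   probability with density proportional to e^(t X). *)
Lemma derive2_phi_gt0 (t : R) : 0 < t ->
  0 < exp_moment X 2 t / exp_moment X 0 t -
     (exp_moment X 1 t / exp_moment X 0 t) ^+ 2.
Proof.
move=> t0; have M0 : 0 < exp_moment X 0 t by rewrite exp_moment0_gt0// ltW.
set m := exp_moment X 1 t / exp_moment X 0 t.
pose f w := (X w - m) ^+ 2 * expR (X w * t).
have i0 := integrable_moment mgf_integrable 0 t0.
have i1 := integrable_moment mgf_integrable 1 t0.
have i2 := integrable_moment mgf_integrable 2 t0.
have fE : f = (fun w => (X w ^+ 2 * expR (X w * t)
    + (- (2 * m)) * (X w ^+ 1 * expR (X w * t)))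
    + m ^+ 2 * (X w ^+ 0 * expR (X w * t))).
  by apply/funext => w; rewrite /f; ring.
have iZ k (h : T -> R) : P.-integrable setT (EFin \o h) ->
    P.-integrable setT (EFin \o (fun w => k * h w)).
  by move=> hi; have := integrableZl measurableT k hi; apply: eq_integrable.
have iD (h1 h2 : T -> R) : P.-integrable setT (EFin \o h1) ->
    P.-integrable setT (EFin \o h2) ->
    P.-integrable setT (EFin \o (fun w => h1 w + h2 w)).
  move=> hi1 hi2; have := integrableD measurableT hi1 hi2.
  exact: eq_integrable.
have i12 : P.-integrable setT (EFin \o (fun w => X w ^+ 2 * expR (X w * t)
    + (- (2 * m)) * (X w ^+ 1 * expR (X w * t)))).
  by apply: iD => //; exact: iZ.
have i00 : P.-integrable setT
   (EFin \o (fun w => m ^+ 2 * (X w ^+ 0 * expR (X w * t)))).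
  exact: iZ.
have fI : \int[P]_w f w = exp_moment X 2 t - 2 * m * exp_moment X 1 t
     + m ^+ 2 * exp_moment X 0 t.
  rewrite fE RintegralD// RintegralD//; last first.
    exact: iZ.
  rewrite RintegralZl// RintegralZl// mulNr //.
have f0 w : 0 <= f w by rewrite mulr_ge0 ?sqr_ge0 ?expR_ge0.
have fi : P.-integrable setT (EFin \o f).
  by rewrite fE; exact: iD.
(* This integral is the claimed quantity times [exp_moment X 0 t]. If it vanished, [X] would equal
   [m] almost surely. *)
suff : 0 < \int[P]_w f w.
  rewrite fI; have -> : exp_moment X 2 t - 2 * m * exp_moment X 1 t
     + m ^+ 2 * exp_moment X 0 t =
     (exp_moment X 2 t / exp_moment X 0 t - m ^+ 2) * exp_moment X 0 t.
    by rewrite /m; field; exact: lt0r_neq0.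
  by rewrite pmulr_lgt0.
rewrite lt_neqAle; apply/andP; split; last exact: Rintegral_ge0.
apply/eqP => /esym f_eq0; apply: X_nondeg; exists m.
have mf : measurable_fun setT (EFin \o f) by exact: measurable_int fi.
have : (\int[P]_(w in setT) `|(EFin \o f) w| = 0)%E.
  under eq_integral do rewrite /= ger0_norm//.
  rewrite -[LHS]fineK ?integrable_fin_num//.
  by move: f_eq0; rewrite /Rintegral => ->.
move/(ae_eq_integral_abs _ measurableT mf).
apply: filterS => w /(_ I) /= [] /eqP.
rewrite mulf_eq0 sqrf_eq0 (gt_eqF (expR_gt0 _)) orbF subr_eq0.
by move/eqP.
Qed.

(** Dominated convergence with bound [1 + expR (X w)], valid because the arguments lie in [0,1].
    Convergence along this one sequence is all that the convexity arguments below use of continuity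
    at 0. *)
Lemma cvg_phi_at0 : phi P X n.+1%:R^-1 @[n --> \oo] --> 0.
Proof.
rewrite -[X in _ --> X]phi0 phiE//.
under eq_fun do rewrite phiE ?invr_ge0//.
apply: continuous_cvg; first exact/continuous_ln/exp_moment0_gt0.
have m0E s : exp_moment X 0 s = \int[P]_w expR (X w * s).
  by apply: eq_Rintegral => w _; rewrite expr0 mul1r.
rewrite m0E; under eq_fun do rewrite m0E.
apply: fine_cvg; rewrite fineK; last first.
  by rewrite integrable_fin_num//; exact: mgf_integrable.
apply: (@dominated_cvg _ _ _ P _ measurableT _ _
  (fun w => (1%:E + (expR (X w * 1))%:E)%E)).
- move=> n; apply/measurable_EFinP.
  by apply: measurableT_comp => //; apply: measurable_funM.
- move=> w _; apply: cvg_EFin; first exact: nearW.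
  apply: continuous_cvg; first exact: continuous_expR.
  by apply: cvgMr; exact: cvg_harmonic.
- by [].
- have := integrableD measurableT
    (finite_measure_integrable_cst P 1 measurableT)
    (mgf_integrable ler01).
  by apply: eq_integrable.
- move=> n w _; rewrite abse_EFin ger0_norm ?expR_ge0//.
  rewrite -EFinD lee_fin mulr1.
  have [x0|x0] := leP 0 (X w).
    apply: (@le_trans _ _ (expR (X w))); last by rewrite lerDr.
    by rewrite ler_expR ler_piMr// invf_le1// ler1n.
  apply: (@le_trans _ _ 1); last by rewrite lerDl expR_ge0.
  by rewrite expR_le1 nmulr_rle0// invr_ge0.
Qed.

End cumulant.

(** * Convexity and the rate function *)

Section convex_legendre.
Context (R : realType) (f : R -> R).
Hypothesis f_derivable : forall t : R, 0 < t -> derivable f t 1.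
Hypothesis f_derive2 : forall t : R, 0 < t ->
  exists2 s : R, 0 < s & is_derive t 1 (derive1 f) s.
Hypothesis f0 : f 0 = 0.
Hypothesis cvg_f_at0 : f n.+1%:R^-1 @[n --> \oo] --> 0.

(** The Legendre transform of [f] at the slope [derive1 f t], parametrized by [t] instead of the
    slope; see [legendre_sup]. *)
Definition legendre (t : R) : R := t * derive1 f t - f t.

Lemma within_continuous_pos (h : R -> R) (s t : R) : 0 < s ->
  (forall u : R, 0 < u -> derivable h u 1) -> {within `[s, t], continuous h}.
Proof.
move=> s0 dh; apply: derivable_within_continuous => u.
by rewrite in_itv/= => /andP[su _]; apply: dh; exact: lt_le_trans su.
Qed.

Lemma derive1_pos_incr (h : R -> R) :
  (forall u : R, 0 < u -> exists2 r : R, 0 < r & is_derive u 1 h r) ->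
  forall s t : R, 0 < s -> s < t -> h s < h t.
Proof.
move=> dh s t s0 st.
have pos u : u \in `]s, t[ -> 0 < u.
  by rewrite in_itv/= => /andP[su _]; exact: lt_trans su.
apply: (@gtr0_derive1_lt_cc _ h s t) => //.
- by move=> u /pos /dh[r _ []].
- by move=> u /pos /dh[r r0 [_ e]]; rewrite derive1E e.
- apply: within_continuous_pos => // u /dh[r _ []] //.
- by rewrite in_itv/= lexx ltW.
- by rewrite in_itv/= lexx ltW.
Qed.

Lemma derive1_incr (s t : R) : 0 < s -> s < t -> derive1 f s < derive1 f t.
Proof. exact: derive1_pos_incr. Qed.

(** The two terms in f' cancel, leaving t f''(t), which is positive; hence the monotonicity
    below. *)
Lemma is_derive_legendre (t s : R) : 0 < t -> is_derive t 1 (derive1 f) s ->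
  is_derive t 1 legendre (t * s).
Proof.
move=> t0 h2.
have h1 : is_derive t 1 f (derive1 f t).
  by rewrite derive1E; apply: DeriveDef => //; exact: f_derivable.
apply: (is_derive_eq (is_deriveB (is_deriveM (is_derive_id t 1) h2) h1)).
by rewrite /GRing.scale/=; ring.
Qed.

Lemma legendre_incr (s t : R) : 0 < s -> s < t -> legendre s < legendre t.
Proof.
apply: derive1_pos_incr => u u0; have [r r0 h] := f_derive2 u0.
by exists (u * r); [rewrite mulr_gt0|exact: is_derive_legendre].
Qed.

Lemma derive1_continuous (t : R) : 0 < t -> {for t, continuous (derive1 f)}.
Proof.
move=> /f_derive2[s _ [h _]]; apply: differentiable_continuous.
exact/derivable1_diffP.
Qed.

Lemma legendre_derivable (t : R) : 0 < t -> derivable legendre t 1.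
Proof.
by move=> t0; have [s _ /(is_derive_legendre t0)[]] := f_derive2 t0.
Qed.

Lemma legendre_continuous (t : R) : 0 < t -> {for t, continuous legendre}.
Proof.
move=> t0; apply: differentiable_continuous.
exact/derivable1_diffP/legendre_derivable.
Qed.

Lemma mean_value_pos (s t : R) : 0 < s -> s < t ->
  exists u, [/\ s < u, u < t & f t - f s = derive1 f u * (t - s)].
Proof.
move=> s0 st.
have d u : u \in `]s, t[ -> is_derive u 1 f (derive1 f u).
  rewrite in_itv/= => /andP[su _]; rewrite derive1E; apply: DeriveDef => //.
  by apply: f_derivable; exact: lt_trans su.
have [u] := MVT st d (within_continuous_pos s0 f_derivable).
by rewrite in_itv/= => /andP[su ut] ->; exists u.
Qed.

(** Convexity: by the mean value theorem the chord has slope f'(u) with u between [s] and [t], and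
    f' is increasing. *)
Lemma tangent_le (s t : R) : 0 < s -> 0 < t ->
  f s + derive1 f s * (t - s) <= f t.
Proof.
move=> s0 t0; have [st|ts|->] := ltgtP s t; last by rewrite subrr mulr0 addr0.
- have [u [su ut e]] := mean_value_pos s0 st.
  rewrite addrC -lerBrDr e ler_pM2r ?subr_gt0//.
  exact/ltW/derive1_incr.
- have [u [tu us e]] := mean_value_pos t0 ts.
  rewrite addrC -lerBrDr -(opprB (f s)) e -mulrN opprB ler_nM2r ?subr_lt0//.
  by apply/ltW/derive1_incr => //; exact: lt_trans tu.
Qed.

(** The tangent at [t], evaluated at [2 * t], gives t f'(t) <= f(2t) - f(t), so [legendre t] is at
    most f(2t) - 2 f(t), which is small near 0. *)
Lemma legendre_small (c : R) : 0 < c ->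
  exists t, [/\ 0 < t, t < 1 & legendre t < c].
Proof.
move=> c0; have c4 : 0 < c / 4 by rewrite divr_gt0.
have /cvgr0_norm_lt/(_ _ c4)[N _ hN] := cvg_f_at0.
have h1 := hN N (leqnn _).
have h2 : `|f N.*2.+2%:R^-1| < c / 4.
  by apply: hN; rewrite /= -addnn leqW// leq_addr.
(* With this choice both [t] and [2 * t] belong to the sequence along which [f] is known to tend to
   0. *)
set t : R := N.*2.+2%:R^-1 in h2.
have t2 : 2 * t = N.+1%:R^-1.
  by rewrite /t -doubleS -muln2 natrM invfM mulrC mulfVK.
have t0 : 0 < t by rewrite invr_gt0.
exists t; split => //; first by rewrite invf_lt1// ltr1n.
have := @tangent_le t (2 * t) t0; rewrite mulr_gt0// => /(_ isT).
move: h1 h2; rewrite -t2 /legendre !ltr_norml => /andP[h1 h1'] /andP[h2 h2'].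
have -> : 2 * t - t = t by ring.
rewrite mulrC; lra.
Qed.

(** The tangent inequality at [t] bounds [legendre t] below by f'(t) s - f(s) for every s > 0, and
    this tends to 0 along s = 1/(n+1). *)
Lemma legendre_ge0 (t : R) : 0 < t -> 0 <= legendre t.
Proof.
move=> t0; rewrite leNgt; apply/negP => h.
have h2 : 0 < - legendre t / 2 by rewrite divr_gt0// oppr_gt0.
have cv : derive1 f t * n.+1%:R^-1 - f n.+1%:R^-1 @[n --> \oo] --> 0.
  rewrite -[X in _ --> X](subr0 0) -[X in X - 0](mulr0 (derive1 f t)).
  by apply: cvgB => //; apply: cvgMr; exact: cvg_harmonic.
have /cvgr0_norm_lt/(_ _ h2)[N _ /(_ N (leqnn _))/=] := cv.
rewrite ltr_norml => /andP[h3 _].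
have N0 : 0 < N.+1%:R^-1 :> R by rewrite invr_gt0.
have := tangent_le t0 N0.
move: h h3; rewrite /legendre; set y := N.+1%:R^-1; set p := derive1 f t.
rewrite mulrBr [t * p]mulrC; lra.
Qed.

(** The tangent inequality bounds every term with [s > 0], with equality at [s = t]. The term
    [s = 0] is 0 and is handled by [legendre_ge0]. *)
Lemma legendre_sup (t : R) : 0 < t ->
  ereal_sup [set (derive1 f t * s - f s)%:E | s in `[0, +oo[] =
  (legendre t)%:E.
Proof.
move=> t0; apply/eqP; rewrite eq_le; apply/andP; split.
  apply: ge_ereal_sup => _ [s + <-]; rewrite /= in_itv/= andbT lee_fin.
  rewrite le_eqVlt => /predU1P[<-|s0].
    by rewrite f0 mulr0 subr0 legendre_ge0.
  have := tangent_le t0 s0; rewrite /legendre mulrBr [t * _]mulrC; lra.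
apply: ereal_sup_ubound; exists t; first by rewrite /= in_itv/= andbT ltW.
by rewrite /legendre mulrC.
Qed.

Lemma legendre_onto (c : R) : 0 < c -> c <= legendre 1 ->
  exists t, [/\ 0 < t, t <= 1 & legendre t = c].
Proof.
move=> c0 c1; have [s [s0 s1 sc]] := legendre_small c0.
have hc : Num.min (legendre s) (legendre 1) <= c
    <= Num.max (legendre s) (legendre 1).
  by rewrite ge_min le_max (ltW sc) c1 orbT.
have [t] := IVT (ltW s1) (within_continuous_pos s0 legendre_derivable) hc.
rewrite in_itv/= => /andP[st t1] tc; exists t; split => //.
exact: lt_le_trans st.
Qed.

Let beta0 : \bar R := lim ((derive1 f t)%:E @[t --> 0^'+]).
Let beta1 : \bar R := lim ((derive1 f t)%:E @[t --> +oo%R]).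

Lemma derive1_le (s t : R) : 0 < s -> s <= t -> derive1 f s <= derive1 f t.
Proof.
by move=> s0; rewrite le_eqVlt => /predU1P[->//|st]; exact/ltW/derive1_incr.
Qed.

Lemma lim_derive1_at0 :
  beta0 = ereal_inf [set (derive1 f t)%:E | t in `]0, +oo[].
Proof.
apply: cvg_lim => //; apply: nondecreasing_at_right_cvge => // s t.
by rewrite !in_itv/= !andbT => s0 _ st; rewrite lee_fin derive1_le.
Qed.

(** Monotonicity of f' is known on positive arguments only; replacing [t] by [Num.max t 1] gives a
    function nondecreasing on the whole line with the same limit. *)
Lemma lim_derive1_aty :
  beta1 = ereal_sup (range (fun t => (derive1 f (Num.max t 1))%:E)).
Proof.
apply: cvg_lim => //.
have h : (derive1 f (Num.max t 1))%:E @[t --> +oo] -->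
    ereal_sup (range (fun t => (derive1 f (Num.max t 1))%:E)).
  apply: nondecreasing_cvge => s t st; rewrite lee_fin derive1_le//.
    by rewrite lt_max ltr01 orbT.
  by rewrite ge_max !le_max st lexx orbT.
apply: cvg_trans h; apply: near_eq_cvg; near=> t.
by rewrite max_l//; near: t; exact: nbhs_pinfty_ge.
Unshelve. all: by end_near. Qed.

Lemma derive1_between (t : R) : 0 < t ->
  (beta0 < (derive1 f t)%:E < beta1)%E.
Proof.
move=> t0; rewrite lim_derive1_at0 lim_derive1_aty; apply/andP; split.
  apply: (@le_lt_trans _ _ (derive1 f (t / 2))%:E).
    apply: ereal_inf_lbound; exists (t / 2) => //.
    by rewrite /= in_itv/= divr_gt0.
  by rewrite lte_fin derive1_incr ?divr_gt0//; lra.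
apply: (@lt_le_trans _ _ (derive1 f (Num.max (t + 1) 1))%:E).
  by rewrite lte_fin derive1_incr// lt_max ltrDl ltr01.
by apply: ereal_sup_ubound; exists (t + 1).
Qed.

Lemma derive1_onto (b : R) : (beta0 < b%:E < beta1)%E ->
  exists2 t, 0 < t & derive1 f t = b.
Proof.
rewrite lim_derive1_at0 lim_derive1_aty => /andP[].
move=> /ereal_inf_lt[_ [s + <-]]; rewrite /= in_itv/= andbT lte_fin => s0 sb.
move=> /ereal_sup_gt[_ [t' _ <-]]; rewrite lte_fin; set t := Num.max _ _ => bt.
have t0 : 0 < t by rewrite lt_max ltr01 orbT.
have st : s <= t.
  by rewrite leNgt; apply/negP => /ltW /(derive1_le t0); lra.
have df' u : 0 < u -> derivable (derive1 f) u 1.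
  by move=> /f_derive2[r _ []].
have hb : Num.min (derive1 f s) (derive1 f t) <= b
    <= Num.max (derive1 f s) (derive1 f t).
  by rewrite ge_min le_max (ltW sb) (ltW bt) orbT.
have [u] := IVT st (within_continuous_pos s0 df') hb.
rewrite in_itv/= => /andP[su _] <-; exists u => //; exact: lt_le_trans su.
Qed.

(** Mean value theorem and continuity of f'. A single increment [s] serves both sides; strictness of
    the two inequalities is what makes the Chernoff exponents positive later. *)
Lemma derive1_bound (t e : R) : 0 < t -> 0 < e ->
  exists s, [/\ 0 < s, s < t, f (t + s) - f t < s * (derive1 f t + e) &
    f (t - s) - f t < - (s * (derive1 f t - e))].
Proof.
move=> t0 e0.
have /cvgrPdist_lt/(_ _ e0)[r /= r0 hr] := derive1_continuous t0.
pose s := Num.min (t / 2) (r / 2).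
have s0 : 0 < s by rewrite lt_min !divr_gt0.
have st : s < t by rewrite gt_min; apply/orP; left; lra.
have sr : s < r by rewrite gt_min; apply/orP; right; lra.
exists s; split => //.
  have ts : t < t + s by rewrite ltrDl.
  have [u [tu us ->]] := mean_value_pos t0 ts.
  have -> : t + s - t = s by ring.
  rewrite mulrC ltr_pM2l// addrC -ltrBlDr.
  have : `|derive1 f t - derive1 f u| < e.
    by apply: hr; rewrite /ball_/= ltr_distlC; apply/andP; split; lra.
  by rewrite distrC => /ltr_normlW.
have ts : t - s < t by rewrite ltrBlDr ltrDl.
have ts0 : 0 < t - s by rewrite subr_gt0.
have [u [tu us h]] := mean_value_pos ts0 ts.
rewrite ltrNr opprB h; have -> : t - (t - s) = s by ring.
rewrite [ltRHS]mulrC ltr_pM2l// ltrBlDr -ltrBlDl.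
have : `|derive1 f t - derive1 f u| < e.
  by apply: hr; rewrite /ball_/= ltr_distlC; apply/andP; split; lra.
by move=> /ltr_normlW.
Qed.

End convex_legendre.

(** * The inverse of the rate function, parametrized by the slope *)

Section rate_inverse.
Context (d : measure_display) (T : measurableType d) (R : realType)
  (P : probability T R) (X : {RV P >-> R}).
Hypothesis log_mgf_fin : forall t : R, 0 <= t -> log_mgf P X t \is a fin_num.
Hypothesis X_nondeg : non_degenerate P X.

Lemma derivable_phi (t : R) : 0 < t -> derivable (phi P X) t 1.
Proof. by move=> t0; have [] := is_derive_phi log_mgf_fin t0. Qed.

Lemma phi_derive2 (t : R) : 0 < t ->
  exists2 s : R, 0 < s & is_derive t 1 (derive1 (phi P X)) s.
Proof.
move=> t0; have := is_derive_derive1_phi log_mgf_fin t0.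
by eexists; [exact: (derive2_phi_gt0 log_mgf_fin X_nondeg t0)|].
Qed.

Lemma rate_derive1_phi (t : R) : 0 < t ->
  rate P X (derive1 (phi P X) t) = (legendre (phi P X) t)%:E.
Proof.
exact: (legendre_sup derivable_phi phi_derive2 (phi0 log_mgf_fin)
  (cvg_phi_at0 log_mgf_fin)).
Qed.

(** A partial inverse can be evaluated once [rate] is injective on the interval: each point there is
    phi'(s) for some s > 0, and its rate is [legendre] at s, strictly increasing in s. *)
Lemma rate_invE (t : R) : 0 < t ->
  rate_inv P X (legendre (phi P X) t) = derive1 (phi P X) t.
Proof.
move=> t0; rewrite /rate_inv -rate_derive1_phi//; set A := [set b | _].
have AE b : A b -> exists2 s, 0 < s & derive1 (phi P X) s = b.
  exact: (derive1_onto phi_derive2).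
have inj : {in A &, injective (rate P X)}.
  move=> _ _ /set_mem/AE[s s0 <-] /set_mem/AE[u u0 <-] h.
  have e : legendre (phi P X) s = legendre (phi P X) u.
    by apply: EFin_inj; rewrite -(rate_derive1_phi s0) -(rate_derive1_phi u0).
  have incr := legendre_incr derivable_phi phi_derive2.
  have [su|us|->//] := ltgtP s u.
    by move: (incr _ _ s0 su); rewrite [ltLHS]e ltxx.
  by move: (incr _ _ u0 us); rewrite [ltRHS]e ltxx.
by apply: (pinvKV _ inj); apply: mem_set; exact: (derive1_between phi_derive2).
Qed.

End rate_inverse.

(** * Independence of disjoint block sums *)

Section pair_of_variables.
Context (d : measure_display) (T : measurableType d) (R : realType)
  (P : probability T R) (Y W : T -> R).
Hypothesis mY : measurable_fun setT Y.
Hypothesis mW : measurable_fun setT W.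

Let YW (w : T) : R * R := (Y w, W w).
Let mYW : measurable_fun setT YW.
Proof. exact: measurable_fun_pair. Qed.
HB.instance Definition _ := isMeasurableFun.Build _ _ _ _ YW mYW.
HB.instance Definition _ := isMeasurableFun.Build _ _ _ _ Y mY.
HB.instance Definition _ := isMeasurableFun.Build _ _ _ _ W mW.

(** Two finite measures on the plane, the law of (Y, W) restricted to [C] and the law of (Y, W)
    scaled by [P C], agree on the pi-system of rectangles, hence everywhere. *)
Lemma indep_pair_event (C : set T) : measurable C ->
  (forall B1 B2 : set R, measurable B1 -> measurable B2 ->
    P (Y @^-1` B1 `&` W @^-1` B2 `&` C) =
    (P (Y @^-1` B1 `&` W @^-1` B2) * P C)%E) ->
  forall G : set (R * R), measurable G ->
    P ((fun w => (Y w, W w)) @^-1` G `&` C) =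
    (P ((fun w => (Y w, W w)) @^-1` G) * P C)%E.
Proof.
move=> mC rect G mG.
have PC0 : 0 <= fine (P C) by exact: fine_ge0.
pose pushYW : {measure set (R * R) -> \bar R} := pushforward (mrestr P mC) YW.
pose m1 := pushYW mYW.
pose m2 : {measure set (R * R) -> \bar R} :=
  mscale (NngNum PC0) (distribution P YW).
have m2E A : m2 A = (P (YW @^-1` A) * P C)%E.
  by rewrite /m2/= /mscale/= fineK ?fin_num_measure// muleC.
rewrite -[RHS]m2E -[LHS]/(m1 G).
pose K := [set A `*` B | A in @measurable _ R & B in @measurable _ R].
apply: (@measure_unique _ _ _ K (fun=> setT)) => //.
- exact: measurable_prod_measurableType.
- move=> _ _ [A1 mA1 [A2 mA2 <-]] [B1 mB1 [B2 mB2 <-]].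
  exists (A1 `&` B1); first exact: measurableI.
  by exists (A2 `&` B2); [exact: measurableI|rewrite setXI].
- by move=> _; exists setT => //; exists setT => //; rewrite setXTT.
- by rewrite bigcup_const//; exists 0%N.
- by move=> _ [B1 mB1 [B2 mB2 <-]]; rewrite m2E; exact: rect.
- move=> _; rewrite (@le_lt_trans _ _ 1%E) ?ltry//.
  apply: probability_le1; apply: measurableI => //.
  by rewrite preimage_setT.
Qed.

(** The rectangle identity makes the joint law the product of the marginals; Tonelli's theorem then
    factors the integral. *)
Lemma indep_ge0_expectationM (f h : R -> R) :
  (forall B1 B2 : set R, measurable B1 -> measurable B2 ->
    P (Y @^-1` B1 `&` W @^-1` B2) = (P (Y @^-1` B1) * P (W @^-1` B2))%E) ->
  measurable_fun setT f -> measurable_fun setT h ->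
  (forall x, 0 <= f x) -> (forall x, 0 <= h x) ->
  (\int[P]_w (f (Y w) * h (W w))%:E =
   (\int[P]_w (f (Y w))%:E) * (\int[P]_w (h (W w))%:E))%E.
Proof.
move=> rect mf mh f0 h0.
pose F (z : R * R) : \bar R := (f z.1 * h z.2)%:E.
have mF : measurable_fun setT F.
  apply/measurable_EFinP; apply: measurable_funM.
    exact: (measurableT_comp mf measurable_fst).
  exact: (measurableT_comp mh measurable_snd).
have F0 z : (0 <= F z)%E by rewrite lee_fin mulr_ge0.
have -> : (\int[P]_w (f (Y w) * h (W w))%:E)%E =
          (\int[distribution P YW]_z F z)%E.
  by rewrite ge0_integral_distribution.
rewrite -(@eq_measure_integral _ _ _ _ _
  (distribution P Y \x distribution P W)%E); last first.
  move=> G mG _; exact: product_measure_unique.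
rewrite fubini_tonelli1//.
have mfE : measurable_fun setT (fun x => (f x)%:E) by exact/measurable_EFinP.
have mhE : measurable_fun setT (fun x => (h x)%:E) by exact/measurable_EFinP.
have hWE : (\int[P]_w (h (W w))%:E)%E = (\int[distribution P W]_y (h y)%:E)%E.
  by rewrite ge0_integral_distribution.
have fYE : (\int[P]_w (f (Y w))%:E)%E = (\int[distribution P Y]_y (f y)%:E)%E.
  by rewrite ge0_integral_distribution.
rewrite hWE fYE -ge0_integralZr//; last first.
  by apply: integral_ge0 => y _; rewrite lee_fin.
  by move=> x _; rewrite lee_fin.
apply: eq_integral => x _; rewrite /fubini_F -ge0_integralZl//; last first.
  by rewrite lee_fin.
by move=> y _; rewrite lee_fin.
Qed.

End pair_of_variables.

(** * Sums of independent variables along an injective sequence of indices *)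

Section block_sums.
Context (d : measure_display) (T : measurableType d) (R : realType)
  (P : probability T R) (I : choiceType) (X : I -> {RV P >-> R}).
Hypothesis X_indep : mutually_independent P X.

Definition cylinder (J : {fset I}) (B : I -> set R) : set T :=
  \bigcap_(i in [set` J]) (X i @^-1` B i).

Lemma measurable_preimage_RV (i : I) (B : set R) :
  measurable B -> measurable (X i @^-1` B).
Proof. by move=> mB; rewrite -[_ @^-1` _]setTI; exact: measurable_funP. Qed.

Lemma measurable_cylinder (J : {fset I}) (B : I -> set R) :
  (forall i, measurable (B i)) -> measurable (cylinder J B).
Proof.
move=> mB; rewrite /cylinder bigcap_fset; apply: bigsetI_measurable => i _.
exact: measurable_preimage_RV.
Qed.

Lemma cylinderU (J J' : {fset I}) (B B' : I -> set R) :
  [disjoint J & J']%fset ->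
  cylinder J B `&` cylinder J' B' =
  cylinder (J `|` J')%fset (fun i => if i \in J then B i else B' i).
Proof.
move=> JJ'; apply/seteqP; split => [w [hJ hJ'] i /=|w h].
  rewrite in_fsetU; case: ifPn => [iJ _|_ /= iJ']; [exact: hJ|exact: hJ'].
split=> i /= iJ.
  by have := h i; rewrite /= in_fsetU iJ; apply.
have := h i; rewrite /= in_fsetU iJ orbT => /(_ isT); case: ifPn => // iJ1.
by move/fdisjointP : JJ' => /(_ _ iJ1); rewrite iJ.
Qed.

Lemma indep_cylinder (J J' : {fset I}) (B B' : I -> set R) :
  (forall i, measurable (B i)) -> (forall i, measurable (B' i)) ->
  [disjoint J & J']%fset ->
  P (cylinder J B `&` cylinder J' B') =
  (P (cylinder J B) * P (cylinder J' B'))%E.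
Proof.
move=> mB mB' JJ'; rewrite cylinderU// /cylinder !X_indep//; last first.
  by move=> i _; case: ifP.
have -> (F : I -> \bar R) : (\prod_(i <- (J `|` J')%fset) F i =
    \prod_(i <- J) F i * \prod_(i <- J') F i)%E.
  rewrite -big_cat; apply: perm_big; apply: uniq_perm => //.
  - rewrite cat_uniq !fset_uniq/= andbT; apply/hasPn => i /= iJ'.
    by apply/negP => iJ; move/fdisjointP : JJ' => /(_ _ iJ); rewrite iJ'.
  - by move=> i; rewrite mem_cat in_fsetU.
congr (_ * _)%E; rewrite [in LHS]big_seq [in RHS]big_seq;
  apply: eq_bigr => i iJ.
  by rewrite iJ.
case: ifPn => // iJ1.
by move/fdisjointP : JJ' => /(_ _ iJ1); rewrite iJ.
Qed.

Lemma cylinder1 (i : I) (D : set R) :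
  cylinder [fset i]%fset (fun=> D) = X i @^-1` D.
Proof.
apply/seteqP; split => [w h|w h j /=]; first by apply: h; rewrite /= inE.
by rewrite inE => /eqP ->.
Qed.

Variable u : nat -> I.
Hypothesis u_inj : injective u.

Definition block_sum (n : nat) (w : T) : R := \sum_(j < n) X (u j) w.

Lemma block_sumS (n : nat) (w : T) :
  block_sum n.+1 w = block_sum n w + X (u n) w.
Proof. by rewrite /block_sum big_ord_recr. Qed.

Lemma measurable_block_sum (n : nat) : measurable_fun setT (block_sum n).
Proof.
by apply: (@measurable_sum _ _ _ setT 'I_n _ (fun j => X (u j) : T -> R)).
Qed.

Lemma measurable_preimage_block_sum (n : nat) (D : set R) :
  measurable D -> measurable (block_sum n @^-1` D).
Proof.
by move=> mD; rewrite -[_ @^-1` _]setTI; exact: measurable_block_sum.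
Qed.

(* Independence of C from the first n variables of the block, restricted to
   the generating pi-system. *)
Definition indep_of_block (n : nat) (C : set T) : Prop :=
  forall (J : {fset I}) (B : I -> set R),
    (forall i, i \in J -> exists2 j, (j < n)%N & i = u j) ->
    (forall i, measurable (B i)) ->
    P (cylinder J B `&` C) = (P (cylinder J B) * P C)%E.

Lemma block_next_fresh (n : nat) (J : {fset I}) :
  (forall i, i \in J -> exists2 j, (j < n)%N & i = u j) ->
  [disjoint J & [fset u n]]%fset.
Proof.
move=> hJ; rewrite fdisjointX1; apply/negP => /hJ[j jn /u_inj nj].
by rewrite nj ltnn in jn.
Qed.

Lemma indep_of_block_next (n : nat) (D : set R) : measurable D ->
  indep_of_block n (X (u n) @^-1` D).
Proof.
move=> mD J B hJ mB; rewrite -cylinder1 indep_cylinder//.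
exact: block_next_fresh.
Qed.

(** Inductive step for [indep_block_sum]: the last variable of the block is moved into the event,
    which stays independent of the remaining ones. *)
Lemma indep_of_block_nextI (n : nat) (D : set R) (C : set T) : measurable D ->
  indep_of_block n.+1 C ->
  P (X (u n) @^-1` D `&` C) = (P (X (u n) @^-1` D) * P C)%E /\
  indep_of_block n (X (u n) @^-1` D `&` C).
Proof.
move=> mD hC; have e : P (X (u n) @^-1` D `&` C) = (P (X (u n) @^-1` D) * P C)%E.
  rewrite -cylinder1 hC// => i; rewrite inE => /eqP ->; by exists n.
split=> // J B hJ mB; rewrite e setIA -cylinder1 cylinderU; last first.
  exact: block_next_fresh.
rewrite hC; last 2 first.
- move=> i; rewrite !inE => /orP[/hJ[j jn ->]|/eqP ->]; last by exists n.
  by exists j => //; exact: leqW.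
- by move=> i; case: ifP.
rewrite -cylinderU ?block_next_fresh// indep_cylinder ?block_next_fresh//.
by rewrite muleA.
Qed.

(** Induction on [n] for all [C] at once. The longer sum is a function of the pair formed by the
    shorter sum and the next variable, so by [indep_pair_event] rectangles suffice. *)
Lemma indep_block_sum (n : nat) (C : set T) (D : set R) :
  measurable C -> indep_of_block n C -> measurable D ->
  P (block_sum n @^-1` D `&` C) = (P (block_sum n @^-1` D) * P C)%E.
Proof.
move=> + + mD; elim: n C D mD => [|n IH] C D mD mC hC.
  have -> : block_sum 0 = cst 0 by apply/funext => w; rewrite /block_sum big_ord0.
  rewrite preimage_cst; case: ifPn => _.
    by rewrite setTI probability_setT mul1e.
  by rewrite set0I measure0 mul0e.
pose G := [set z : R * R | D (z.1 + z.2)].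
have mG : measurable G.
  have mp : measurable_fun setT (fun z : R * R => z.1 + z.2).
    by apply: measurable_funD; [exact: measurable_fst|exact: measurable_snd].
  by have := mp measurableT _ mD; rewrite setTI.
have -> : block_sum n.+1 @^-1` D =
    (fun w => (block_sum n w, X (u n) w)) @^-1` G.
  by apply/seteqP; split => w; rewrite /preimage/= block_sumS.
apply: indep_pair_event => //; first exact: measurable_block_sum.
move=> B1 B2 mB1 mB2.
have [e h] := indep_of_block_nextI mB2 hC.
(* The induction hypothesis serves twice: for the event of the last variable intersected with [C],
   then for that event alone. *)
rewrite -setIA IH//; last first.
  by apply: measurableI => //; exact: measurable_preimage_RV.
rewrite e IH//; last exact: indep_of_block_next.
  by rewrite muleA.
exact: measurable_preimage_RV.
Qed.

Lemma expR_block_sum (t : R) (n : nat) :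
  (\int[P]_w (expR (block_sum n w * t))%:E =
   \prod_(j < n) \int[P]_w (expR (X (u j) w * t))%:E)%E.
Proof.
have me : measurable_fun setT (fun x : R => expR (x * t)).
  by apply: measurableT_comp => //; exact: measurable_funM.
elim: n => [|n IH].
  rewrite big_ord0 -[RHS](probability_setT P) -[RHS]mul1e -integral_cst//.
  by apply: eq_integral => w _; rewrite /block_sum big_ord0 mul0r expR0.
rewrite big_ord_recr -IH/=.
rewrite -(@indep_ge0_expectationM _ _ _ P (block_sum n) (X (u n)) _ _
  (fun x => expR (x * t)) (fun x => expR (x * t)))//.
- by apply: eq_integral => w _; rewrite block_sumS mulrDl expRD.
- exact: measurable_block_sum.
- move=> B1 B2 mB1 mB2; apply: indep_block_sum => //.
    exact: measurable_preimage_RV.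
  exact: indep_of_block_next.
Qed.

End block_sums.

(** Two passes of [indep_block_sum]: the first reduces the [u]-sum to cylinders over the [u]-block,
    the second does the same for the [v]-sum. Cylinders over disjoint index sets are independent. *)
Lemma indep_disjoint_block_sums (d : measure_display) (T : measurableType d)
    (R : realType) (P : probability T R) (I : choiceType)
    (X : I -> {RV P >-> R}) (u v : nat -> I) (n m : nat) (D E : set R) :
  mutually_independent P X -> injective u -> injective v ->
  (forall i j, u i != v j) -> measurable D -> measurable E ->
  P (block_sum X u n @^-1` D `&` block_sum X v m @^-1` E) =
  (P (block_sum X u n @^-1` D) * P (block_sum X v m @^-1` E))%E.
Proof.
move=> X_indep u_inj v_inj uv mD mE.
apply: indep_block_sum => //; first exact: measurable_preimage_block_sum.
move=> J B hJ mB; rewrite setIC muleC.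
apply: indep_block_sum => //; first exact: measurable_cylinder.
move=> J' B' hJ' mB'; apply: indep_cylinder => //.
apply/fdisjointP => i /hJ'[j _ ->]; apply/negP => /hJ[k _ e].
by have := uv k j; rewrite e eqxx.
Qed.

(** * Counting independent events *)

Section counting.
Context (d : measure_display) (T : measurableType d) (R : realType)
  (P : probability T R) (N : nat) (A : 'I_N -> set T).
Hypothesis mA : forall i, measurable (A i).

Definition count_events (w : T) : R := \sum_(i < N) \1_(A i) w.

Lemma measurable_count_events : measurable_fun setT count_events.
Proof.
apply: (@measurable_sum _ _ _ setT 'I_N _ (fun i => \1_(A i) : T -> R)) => i.
exact: measurable_indic.
Qed.

Lemma count_events_ge0 (w : T) : 0 <= count_events w.
Proof. by apply: sumr_ge0 => i _; rewrite indicE. Qed.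

Lemma integral_count_events :
  (\int[P]_w (count_events w)%:E = \sum_(i < N) P (A i))%E.
Proof.
under eq_integral do rewrite /count_events -sumEFin.
rewrite ge0_integral_sum//; last first.
  by move=> i; apply/measurable_EFinP; exact: measurable_indic.
by apply: eq_bigr => i _; rewrite integral_indic// setIT.
Qed.

Lemma integral_sqr_count_events :
  (\int[P]_w (count_events w ^+ 2)%:E =
   \sum_(i < N) \sum_(k < N) P (A i `&` A k))%E.
Proof.
transitivity (\int[P]_w (\sum_(i < N) \sum_(k < N)
    (\1_(A i `&` A k) w)%:E : \bar R))%E.
  apply: eq_integral => w _; rewrite /count_events expr2 big_distrlr/= -sumEFin.
  by apply: eq_bigr => i _; rewrite -sumEFin; apply: eq_bigr => k _; rewrite indicI.
have mI i k : measurable_fun setT (fun w => (\1_(A i `&` A k) w)%:E : \bar R).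
  by apply/measurable_EFinP; apply: measurable_indic; exact: measurableI.
rewrite ge0_integral_sum//; last 2 first.
- by move=> i; exact: emeasurable_sum.
- by move=> i w _; apply: sume_ge0 => k _; rewrite lee_fin indicE.
apply: eq_bigr => i _; rewrite ge0_integral_sum//.
apply: eq_bigr => k _; rewrite integral_indic ?setIT//; exact: measurableI.
Qed.

Hypothesis A_indep : forall i k, i != k -> P (A i `&` A k) = (P (A i) * P (A k))%E.

(* Integrates (mu/2)^2 [K < mu/2] + 2 mu K <= K^2 + mu^2, where K counts the
   events that occur and mu is its mean. *)
Lemma count_events_lower (mu : R) : 0 < mu ->
  (\sum_(i < N) P (A i) = mu%:E)%E ->
  (P [set w | (count_events w < mu / 2)%R] <= (4 / mu)%:E)%E.
Proof.
move=> mu0 muE; set B := [set w | _].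
have mB : measurable B.
  by apply: measurable_set_lt; exact: measurable_count_events.
have PE (C : set T) : measurable C -> P C = (fine (P C))%:E.
  by move=> mC; rewrite fineK// fin_num_measure.
pose p i := fine (P (A i)).
have pE i : P (A i) = (p i)%:E by rewrite /p -PE.
have p0 i : 0 <= p i by exact: fine_ge0.
have psum : \sum_(i < N) p i = mu.
  apply: EFin_inj; rewrite -muE -sumEFin; apply: eq_bigr => i _.
  by rewrite pE.
have int1 : (\int[P]_w (count_events w)%:E = mu%:E)%E.
  by rewrite integral_count_events.
(* The diagonal terms sum to [mu]; by pairwise independence the others sum to at most [mu ^+ 2]. *)
have int2 : (\int[P]_w (count_events w ^+ 2)%:E <= (mu ^+ 2 + mu)%:E)%E.
  rewrite integral_sqr_count_events.
  apply: (@le_trans _ _ (\sum_(i < N) (p i * mu + p i)%:E)%E); last first.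
    by rewrite sumEFin big_split/= -mulr_suml psum -expr2.
  apply: lee_sum => i _; rewrite (bigD1 i)//= setIid addeC pE EFinD leeD2r//.
  rewrite -psum mulr_sumr [X in (_ <= X%:E)%E](bigD1 i)//= EFinD -sumEFin.
  apply: le_trans (leeDr _ _); last by rewrite lee_fin mulr_ge0.
  apply: lee_sum => k ki; rewrite A_indep 1?eq_sym//.
  by rewrite !pE.
have mK : measurable_fun setT (fun w => (count_events w)%:E).
  by apply/measurable_EFinP; exact: measurable_count_events.
have mK2 : measurable_fun setT (fun w => (count_events w ^+ 2)%:E).
  apply/measurable_EFinP; apply: measurable_funX.
  exact: measurable_count_events.
have m1B : measurable_fun setT (fun w => (\1_B w)%:E : \bar R).
  by apply/measurable_EFinP; exact: measurable_indic.
have mu20 : 0 <= (mu / 2) ^+ 2 by exact: sqr_ge0.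
have h : (\int[P]_w (((mu / 2) ^+ 2)%:E * (\1_B w)%:E +
      (2 * mu)%:E * (count_events w)%:E) <=
    \int[P]_w ((count_events w ^+ 2)%:E + (mu ^+ 2)%:E))%E.
  apply: ge0_le_integral => //.
  - move=> w _; rewrite -!EFinM -EFinD lee_fin addr_ge0// mulr_ge0//.
      by rewrite mulr_ge0// ltW.
    exact: count_events_ge0.
  - by apply: emeasurable_funD; apply: measurable_funeM.
  - exact: (emeasurable_funD mK2 (measurable_cst (mu ^+ 2)%:E)).
  - move=> w _; rewrite -!EFinM -!EFinD lee_fin indicE.
    have K0 := count_events_ge0 w.
    case: (boolP (w \in B)) => [/set_mem|_].
      rewrite /B/= mulr1 => Bw; have : 0 <= mu / 2 - count_events w by lra.
      by nra.
    by rewrite mulr0 add0r; have := sqr_ge0 (count_events w - mu); nra.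
have e1 : (\int[P]_w (((mu / 2) ^+ 2)%:E * (\1_B w)%:E +
    (2 * mu)%:E * (count_events w)%:E) =
    ((mu / 2) ^+ 2)%:E * P B + (2 * mu)%:E * mu%:E)%E.
  have K0 w : (0 <= (count_events w)%:E)%E by rewrite lee_fin count_events_ge0.
  have m2 : (0 <= (2 * mu)%:E)%E by rewrite lee_fin mulr_ge0// ltW.
  have b0 w : (0 <= (\1_B w)%:E :> \bar R)%E by rewrite lee_fin.
  rewrite ge0_integralD//; first last.
  - exact: measurable_funeM.
  - by move=> w _; rewrite mule_ge0.
  - exact: measurable_funeM.
  - by move=> w _; rewrite mule_ge0.
  by rewrite !ge0_integralZl// int1 integral_indic// setIT.
have e2 : (\int[P]_w ((count_events w ^+ 2)%:E + (mu ^+ 2)%:E) =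
    \int[P]_w (count_events w ^+ 2)%:E + (mu ^+ 2)%:E)%E.
  rewrite ge0_integralD//; first last.
  - by move=> w _; rewrite lee_fin sqr_ge0.
  - by move=> w _; rewrite lee_fin sqr_ge0.
  by rewrite integral_cst//= probability_setT mule1.
rewrite e1 e2 in h.
have {h} := le_trans h (leeD2r _ int2).
rewrite (PE _ mB) -!EFinM -!EFinD !lee_fin => h.
(* After cancelling [2 * mu ^+ 2] there remains (mu/2)^2 P(B) <= mu. *)
rewrite ler_pdivlMr//; nra.
Qed.

End counting.

(** * Tail bounds *)

Section branching_sums.
Context (R : realType)
  (d0 : measure_display) (T0 : measurableType d0) (P0 : probability T0 R)
  (X0 : {RV P0 >-> R}).
Hypothesis log_mgf_fin :
  forall t : R, 0 <= t -> log_mgf P0 X0 t \is a fin_num.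
Context (d : measure_display) (T : measurableType d) (P : probability T R)
  (X : nat * nat -> {RV P >-> R}).
Hypothesis X_indep : mutually_independent P X.
Hypothesis X_copies : forall ij, same_distribution P P0 (X ij) X0.

Local Notation phi := (phi P0 X0).
Local Notation S := (fun i n => block_sum X (pair i) n).

Lemma pair_inj (i : nat) : injective (@pair nat nat i).
Proof. by move=> j k []. Qed.

Lemma mgf_copy (ij : nat * nat) (t : R) : 0 <= t ->
  (\int[P]_w (expR (X ij w * t))%:E = (expR (phi t))%:E)%E.
Proof.
move=> t0; rewrite -expR_phi//.
have me : measurable_fun setT (fun x : R => (expR (x * t))%:E).
  apply/measurable_EFinP; apply: measurableT_comp => //.
  exact: measurable_funM.
have e0 (x : R) : (0 <= (expR (x * t))%:E)%E by rewrite lee_fin expR_ge0.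
have := ge0_integral_distribution (X ij) me e0.
have := ge0_integral_distribution X0 me e0.
rewrite /comp/= => <- <-; apply: eq_measure_integral => A mA _.
exact: X_copies.
Qed.

Lemma mgf_row (i n : nat) (t : R) : 0 <= t ->
  (\int[P]_w (expR (S i n w * t))%:E = (expR (n%:R * phi t))%:E)%E.
Proof.
move=> t0; rewrite expR_block_sum//; last exact: pair_inj.
rewrite expRM_natl; under eq_bigr do rewrite mgf_copy//.
by rewrite prodEFin prodr_const card_ord.
Qed.

Lemma measurable_row (i n : nat) : measurable_fun setT (S i n).
Proof. exact: measurable_block_sum. Qed.

Lemma measurable_mgf_row (i n : nat) (t x : R) :
  measurable_fun setT (fun w => (expR (S i n w * t + x))%:E).
Proof.
apply/measurable_EFinP; apply: measurableT_comp => //.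
apply: measurable_funD => //; apply: measurable_funM => //.
exact: measurable_row.
Qed.

Lemma mgf_row_shift (i n : nat) (t x : R) : 0 <= t ->
  (\int[P]_w (expR (S i n w * t + x))%:E = (expR (n%:R * phi t + x))%:E)%E.
Proof.
move=> t0; under eq_integral do rewrite expRD EFinM.
rewrite ge0_integralZr.
- by rewrite mgf_row// expRD EFinM.
- exact: measurableT.
- apply/measurable_EFinP; apply: measurableT_comp => //.
  by apply: measurable_funM => //; exact: measurable_row.
- by move=> w _; rewrite lee_fin expR_ge0.
- by rewrite lee_fin expR_ge0.
Qed.

Variable N : nat -> nat.
Local Notation Z := (Z P X N).

Lemma ZE (n : nat) (w : T) : Z n w = \sum_(i < N n) expR (S i n w).
Proof. by apply: eq_bigr => i _; rewrite /block_sum expR_sum. Qed.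

Lemma measurable_Z (n : nat) : measurable_fun setT (Z n).
Proof.
rewrite (funext (ZE n)).
apply: (@measurable_sum _ _ _ setT 'I_(N n) _
  (fun i w => expR (S i n w))) => i.
by apply: measurableT_comp => //; exact: measurable_row.
Qed.

Lemma Z_gt0 (n : nat) (w : T) : (0 < N n)%N -> 0 < Z n w.
Proof.
move=> N0; rewrite ZE (bigD1 (Ordinal N0))//= ltr_pwDl ?expR_gt0//.
by apply: sumr_ge0 => i _; exact: expR_ge0.
Qed.

(* Since each S i n is at most y := ln (Z n), subadditivity of z^a for a <= 1
   follows from S i n * a >= S i n - (1 - a) * y. *)
Lemma expR_le_Z (n : nat) (w : T) (a x : R) : 0 <= a -> a <= 1 ->
  expR x <= Z n w -> 1 <= \sum_(i < N n) expR (S i n w * a + - (a * x)).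
Proof.
move=> a0 a1 xZ; have Z0 : 0 < Z n w by apply: lt_le_trans xZ; exact: expR_gt0.
pose y := ln (Z n w).
have yE : expR y = Z n w by rewrite lnK.
have xy : x <= y by rewrite -ler_expR yE.
have Sy (i : 'I_(N n)) : S i n w <= y.
  rewrite -ler_expR yE ZE (bigD1 i)//= lerDl.
  by apply: sumr_ge0 => k _; exact: expR_ge0.
apply: (@le_trans _ _ (\sum_(i < N n) expR (S i n w) * expR (- y))).
  by rewrite -mulr_suml -ZE -yE -expRD subrr expR0.
apply: ler_sum => i _; rewrite -expRD ler_expR.
have h1 : 0 <= a * (y - x) by rewrite mulr_ge0// subr_ge0.
have h2 : 0 <= (1 - a) * (y - S i n w) by rewrite mulr_ge0// subr_ge0.
by move: h1 h2; nra.
Qed.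

Lemma Z_upper_tail (n : nat) (a x : R) : 0 <= a -> a <= 1 ->
  (P [set w | (expR x <= Z n w)%R] <=
   ((N n)%:R * expR (n%:R * phi a - a * x))%:E)%E.
Proof.
move=> a0 a1; set B := [set w | _].
have mB : measurable B by apply: measurable_set_ge; exact: measurable_Z.
rewrite -[X in P X]setIT -integral_indic//.
apply: (@le_trans _ _
  (\int[P]_w (\sum_(i < N n) (expR (S i n w * a + - (a * x)))%:E))%E).
  apply: ge0_le_integral => //.
  - by apply/measurable_EFinP; exact: measurable_indic.
  - by apply: emeasurable_sum => i; exact: measurable_mgf_row.
  - move=> w _; rewrite sumEFin lee_fin indicE; case: (boolP (w \in B)).
      by move=> /set_mem Bw; exact: expR_le_Z.
    by move=> _; apply: sumr_ge0 => i _; exact: expR_ge0.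
rewrite ge0_integral_sum.
- rewrite (eq_bigr (fun=> (expR (n%:R * phi a - a * x))%:E)); last first.
    by move=> i _; exact: mgf_row_shift.
  by rewrite sumEFin sumr_const card_ord -[_ *+ N n]mulr_natl.
- exact: measurableT.
- by move=> i; exact: measurable_mgf_row.
- by move=> i w _; rewrite lee_fin expR_ge0.
Qed.

Lemma measurable_row_ge (i n : nat) (x : R) :
  measurable [set w | x <= S i n w].
Proof. by apply: measurable_set_ge; exact: measurable_row. Qed.

(* Chernoff's bounds under the law tilted by exp(a S): the mass of exp(a S)
   outside of the window |S/n - phi'(a)| < eta is exponentially negligible. *)
Lemma row_lower_tail (a eta : R) : 0 < a -> 0 < eta ->
  (forall t : R, 0 < t -> derivable phi t 1) ->
  (forall t : R, 0 < t -> exists2 s : R, 0 < s & is_derive t 1 (derive1 phi) s) ->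
  exists2 delta : R, 0 < delta & forall i n : nat,
    ((expR (- (n%:R * (legendre phi a + a * eta))) *
      (1 - 2 * expR (- (n%:R * delta))))%:E <=
    P [set w | (n%:R * (derive1 phi a - eta) <= S i n w)%R])%E.
Proof.
move=> a0 eta0 dphi d2phi.
have [s [s0 sa]] := derive1_bound dphi d2phi a0 eta0.
set b := derive1 phi a => up dn.
pose d1 := phi a - phi (a + s) + s * (b + eta).
pose d2 := phi a - phi (a - s) - s * (b - eta).
pose delta := Num.min d1 d2.
have d10 : 0 < d1 by rewrite /d1; lra.
have d20 : 0 < d2 by rewrite /d2; lra.
exists delta; first by rewrite lt_min d10.
move=> i n; set A := [set w | _].
have mA : measurable A by exact: measurable_row_ge.
have PA : P A = (fine (P A))%:E by rewrite fineK// fin_num_measure.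
set p := fine (P A) in PA *.
have n0 : 0 <= n%:R :> R by [].
(* [E0] bounds exp(a S) where S <= n (b + eta); [r1] and [r2] normalize the shifted exponentials to
   dominate exp(a S) above and below the window. *)
pose E0 := expR (n%:R * (a * (b + eta))).
pose r1 := - (n%:R * (s * (b + eta))).
pose r2 := n%:R * (s * (b - eta)).
have main : (\int[P]_w (expR (S i n w * a))%:E <=
    \int[P]_w (E0%:E * (\1_A w)%:E + (expR (S i n w * (a + s) + r1))%:E
       + (expR (S i n w * (a - s) + r2))%:E))%E.
  apply: ge0_le_integral => //.
  - apply/measurable_EFinP; apply: measurableT_comp => //.
    by apply: measurable_funM => //; exact: measurable_row.
  - apply: emeasurable_funD; last exact: measurable_mgf_row.
    apply: emeasurable_funD; last exact: measurable_mgf_row.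
    by apply/measurable_funeM/measurable_EFinP; exact: measurable_indic.
  - move=> w _; rewrite -!EFinM -!EFinD lee_fin indicE; set x := S i n w.
    have e1 := expR_ge0 (x * (a + s) + r1).
    have e2 := expR_ge0 (x * (a - s) + r2).
    have E00 : 0 <= E0 by exact: expR_ge0.
    case: (boolP (w \in A)) => [_|wA].
      rewrite mulr1; have [xb|xb] := leP x (n%:R * (b + eta)).
        apply: (@le_trans _ _ E0); last by rewrite -addrA lerDl addr_ge0.
        by rewrite ler_expR mulrC mulrCA ler_wpM2l// ltW.
      apply: (@le_trans _ _ (expR (x * (a + s) + r1))).
        have : 0 <= s * (x - n%:R * (b + eta)) by rewrite mulr_ge0 ?ltW// subr_gt0.
        by rewrite ler_expR /r1; lra.
      by rewrite [E0 + _]addrC -addrA lerDl addr_ge0.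
    rewrite mulr0 add0r; apply: (@le_trans _ _ (expR (x * (a - s) + r2))).
      have xb : x <= n%:R * (b - eta).
        apply: ltW; rewrite ltNge; apply/negP => xb; move/negP: wA; apply.
        exact: mem_set.
      have : 0 <= s * (n%:R * (b - eta) - x) by rewrite mulr_ge0 ?subr_ge0// ltW.
      by rewrite ler_expR /r2; lra.
    by rewrite lerDr.
have as0 : 0 <= a - s by rewrite subr_ge0 ltW.
have as1 : 0 <= a + s by rewrite addr_ge0 ?ltW.
have mI : measurable_fun setT (fun w => (E0%:E * (\1_A w)%:E)%E).
  by apply/measurable_funeM/measurable_EFinP; exact: measurable_indic.
have I0 w : (0 <= E0%:E * (\1_A w)%:E)%E.
  by rewrite -EFinM lee_fin mulr_ge0// expR_ge0.
have e0 (x : R) : (0 <= (expR x)%:E)%E by rewrite lee_fin expR_ge0.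
rewrite (mgf_row i n (ltW a0)) in main.
have := main; rewrite ge0_integralD; last 5 first.
- exact: measurableT.
- by move=> w _; exact: adde_ge0.
- by apply: emeasurable_funD => //; exact: measurable_mgf_row.
- by move=> w _; exact: e0.
- exact: measurable_mgf_row.
rewrite ge0_integralD; last 5 first.
- exact: measurableT.
- by move=> w _; exact: I0.
- exact: mI.
- by move=> w _; exact: e0.
- exact: measurable_mgf_row.
rewrite !mgf_row_shift// ge0_integralZl; last 4 first.
- exact: measurableT.
- by apply/measurable_EFinP; exact: measurable_indic.
- by move=> w _; rewrite lee_fin.
- by rewrite lee_fin expR_ge0.
rewrite integral_indic// setIT [X in (E0%:E * X)%E]PA PA -EFinM -!EFinD !lee_fin => {}main.
(* [q * E0] is the full mass of exp(a S), and each of the two error terms is at most that mass times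
   exp(- n delta). *)
pose q := expR (- (n%:R * (legendre phi a + a * eta))).
have qE : q * E0 = expR (n%:R * phi a).
  by rewrite -expRD /legendre -/b; congr expR; ring.
have h1 : expR (n%:R * phi (a + s) + r1) <= q * E0 * expR (- (n%:R * delta)).
  rewrite qE -expRD ler_expR -mulrN -mulrDr /r1 -mulrN -mulrDr ler_wpM2l//.
  have : delta <= d1 by rewrite /delta ge_min lexx.
  by rewrite /d1; lra.
have h2 : expR (n%:R * phi (a - s) + r2) <= q * E0 * expR (- (n%:R * delta)).
  rewrite qE -expRD ler_expR -mulrN -mulrDr /r2 -mulrDr ler_wpM2l//.
  have : delta <= d2 by rewrite /delta ge_min lexx orbT.
  by rewrite /d2; lra.
rewrite -qE in main.
have E00 : 0 < E0 by exact: expR_gt0.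
rewrite -(ler_pM2l E00) -/q; move: main h1 h2.
by set y := expR (- _); nra.
Qed.

End branching_sums.

(** * Convergence *)

Section convergence.
Context (R : realType)
  (d0 : measure_display) (T0 : measurableType d0) (P0 : probability T0 R)
  (X0 : {RV P0 >-> R}).
Hypothesis log_mgf_fin :
  forall t : R, 0 <= t -> log_mgf P0 X0 t \is a fin_num.
Hypothesis X0_nondeg : non_degenerate P0 X0.
Context (d : measure_display) (T : measurableType d) (P : probability T R)
  (X : nat * nat -> {RV P >-> R}).
Hypothesis X_indep : mutually_independent P X.
Hypothesis X_copies : forall ij, same_distribution P P0 (X ij) X0.
Variable N : nat -> nat.

Local Notation phi := (phi P0 X0).
Local Notation S := (fun i n => block_sum X (pair i) n).
Local Notation Z := (Z P X N).

(** Each row with S >= x contributes at least [expR x], so a small [Z] forces fewer than half the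
    expected number [mu] of such rows; finally [mu >= N n * q]. *)
Lemma Z_lower_tail (n : nat) (x q : R) : (0 < N n)%N -> 0 < q ->
  (forall i, (q%:E <= P [set w | (x <= S i n w)%R])%E) ->
  (P [set w | (Z n w < (N n)%:R * q / 2 * expR x)%R] <=
   (4 / ((N n)%:R * q))%:E)%E.
Proof.
move=> N0 q0 hq; pose A (i : 'I_(N n)) := [set w | x <= S i n w].
have mA i : measurable (A i) by exact: measurable_row_ge.
have AE (i : nat) : [set w | x <= S i n w] = S i n @^-1` `[x, +oo[.
  by apply/seteqP; split => w; rewrite /= in_itv/= andbT.
have A_indep i k : i != k -> P (A i `&` A k) = (P (A i) * P (A k))%E.
  move=> ik; rewrite /A !AE; apply: indep_disjoint_block_sums => //.
  - exact: pair_inj.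
  - exact: pair_inj.
  - by move=> j l; apply: contra ik => /eqP[/val_inj ->].
pose mu := \sum_(i < N n) fine (P (A i)).
have muE : (\sum_(i < N n) P (A i) = mu%:E)%E.
  rewrite /mu -sumEFin; apply: eq_bigr => i _.
  by rewrite fineK// fin_num_measure.
have Nq0 : 0 < (N n)%:R * q by rewrite mulr_gt0// ltr0n.
have Nqmu : (N n)%:R * q <= mu.
  rewrite /mu mulr_natl -[X in _ *+ X]card_ord -sumr_const.
  apply: ler_sum => i _; rewrite -lee_fin fineK ?fin_num_measure//.
  exact: hq.
have mu0 : 0 < mu by exact: lt_le_trans Nqmu.
apply: (@le_trans _ _ (4 / mu)%:E); last first.
  by rewrite lee_fin ler_wpM2l// lef_pV2.
apply: le_trans (count_events_lower mA A_indep mu0 muE).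
apply: le_measure.
- by rewrite inE; apply: measurable_set_lt; exact: measurable_Z.
- by rewrite inE; apply: measurable_set_lt; exact: measurable_count_events.
move=> w /= Zw; rewrite -(ltr_pM2r (expR_gt0 x)).
apply: (@le_lt_trans _ _ (Z n w)); last first.
  apply: (lt_le_trans Zw); rewrite ler_wpM2r ?expR_ge0//.
  by rewrite ler_wpM2r ?invr_ge0.
rewrite ZE /count_events mulr_suml; apply: ler_sum => i _.
rewrite indicE; case: (boolP (w \in A i)) => [/set_mem Aw|_].
  by rewrite mul1r ler_expR.
by rewrite mul0r expR_ge0.
Qed.

Lemma cvg_expR_decay (k : R) : 0 < k ->
  expR (- (n%:R * k)) @[n --> \oo] --> (0 : R).
Proof.
move=> k0; under eq_fun do rewrite -mulrN expRM_natl.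
apply: cvg_expr; rewrite ger0_norm ?expR_ge0//.
by rewrite expR_lt1 oppr_lt0.
Qed.

Variable c : R.
Hypothesis N_cvg : expR (- (c * n%:R)) * (N n)%:R @[n --> \oo] --> (1 : R).

(** The only consequence of the asymptotics of [N] used below; constant factors disappear after
    division of the logarithm by n. *)
Lemma N_near : \forall n \near \oo,
  expR (c * n%:R) / 2 <= (N n)%:R <= 2 * expR (c * n%:R).
Proof.
near=> n.
have e0 := expR_gt0 (c * n%:R).
have h1 : 1 / 2 <= expR (- (c * n%:R)) * (N n)%:R.
  near: n; apply: (cvgr_ge _ N_cvg); lra.
have h2 : expR (- (c * n%:R)) * (N n)%:R <= 2.
  near: n; apply: (cvgr_le _ N_cvg); lra.
move: h1 h2; rewrite expRN ler_pdivlMl// ler_pdivrMl//.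
by move=> h1 h2; apply/andP; split; lra.
Unshelve. all: by end_near. Qed.

Lemma Z_cvg_in_probability (a l : R) :
  0 < a -> a <= 1 -> legendre phi a <= c ->
  a * l = phi a + c -> l = c - legendre phi a + derive1 phi a ->
  cvg_in_probability P (fun n w => n%:R^-1 * ln (Z n w)) l.
Proof.
move=> a0 a1 gc al lE eps eps0.
have dphi := derivable_phi log_mgf_fin.
have d2phi := phi_derive2 log_mgf_fin X0_nondeg.
(* Moving strictly below [a] makes the inequality with [c] strict even when [legendre phi a = c];
   continuity keeps the loss in the limit below [eps / 2]. *)
have [b [b0 ba gb lb]] : exists b, [/\ 0 < b, b < a, legendre phi b < c &
    l - eps / 2 < c - legendre phi b + derive1 phi b].
  have cont : {for a, continuous (fun b => c - legendre phi b + derive1 phi b)}.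
    apply: continuousD; last exact: derive1_continuous.
    by apply: continuousB; [exact: cvg_cst|exact: legendre_continuous].
  have eps2 : 0 < eps / 2 by rewrite divr_gt0.
  have /cvgrPdist_lt/(_ _ eps2)[r /= r0 hr] := cont.
  pose b := a - Num.min (a / 2) (r / 2).
  have m0 : 0 < Num.min (a / 2) (r / 2) by rewrite lt_min !divr_gt0.
  have ma : Num.min (a / 2) (r / 2) <= a / 2 by rewrite ge_min lexx.
  have mr : Num.min (a / 2) (r / 2) <= r / 2 by rewrite ge_min lexx orbT.
  have b0 : 0 < b by rewrite /b; lra.
  have ba : b < a by rewrite /b; lra.
  exists b; split => //.
    by apply: lt_le_trans gc; exact: (legendre_incr dphi d2phi).
  have : `|a - b| < r by rewrite ger0_norm ?subr_ge0 ?ltW// /b; lra.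
  by move=> /hr; rewrite -lE => /ltr_normlW; lra.
pose k := c - legendre phi b.
(* Since [b < 1], the total loss [b * eta + 2 * eta] in [exponent2] is at most [eps / 2], and
   [b * eta] uses at most half of the gap [k]. *)
pose eta := Num.min (eps / 6) (k / 2).
have k0 : 0 < k by rewrite subr_gt0.
have eta0 : 0 < eta by rewrite lt_min !divr_gt0.
have eta1 : eta <= eps / 6 by rewrite ge_min lexx.
have eta2 : eta <= k / 2 by rewrite ge_min lexx orbT.
have b1 : b < 1 by exact: lt_le_trans a1.
have beta : b * eta <= eta by rewrite ler_piMl// ltW.
have exponent1 : k / 2 <= c - (legendre phi b + b * eta).
  by have := eta2; have := beta; rewrite /k; lra.
have exponent2 : l - eps <=
    c - (legendre phi b + b * eta) + (derive1 phi b - eta) - eta by lra.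
have half (y : R) : y <= 1 / 4 -> 1 / 2 <= 1 - 2 * y by lra.
have quarter (y z : R) : y / 4 <= z -> 4 * y <= 16 * z by lra.
have [delta delta0 tail] := row_lower_tail log_mgf_fin X_indep X_copies b0 eta0
  dphi d2phi.
(* First term: the upper tail with N n <= 2 exp(c n). Second term: the bound 4 / (N n q) with N n q
   >= exp(n k / 2) / 4. *)
pose u n : R := 2 * expR (- (n%:R * (a * eps))) + 16 * expR (- (n%:R * (k / 2))).
have u_cvg : (u n)%:E @[n --> \oo] --> 0%E.
  apply: cvg_EFin; first exact: nearW.
  rewrite /u -[X in _ --> X]addr0 -[X in _ --> X + _](mulr0 2).
  rewrite -[X in _ --> _ + X](mulr0 16).
  apply: cvgD; apply: cvgMr; apply: cvg_expR_decay; first exact: mulr_gt0.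
  by rewrite divr_gt0.
apply: (squeeze_cvge _ (cvg_cst 0%E) u_cvg).
near=> n; rewrite measure_ge0 /=.
have n0 : 0 < n%:R :> R by rewrite ltr0n; near: n; exact: nbhs_infty_gt.
have /andP[N1 N2] : expR (c * n%:R) / 2 <= (N n)%:R <= 2 * expR (c * n%:R).
  by near: n; exact: N_near.
have N0 : (0 < N n)%N.
  by rewrite -(ltr0n R); apply: lt_le_trans N1; rewrite divr_gt0// expR_gt0.
(* This makes the Chernoff factor at least 1/2. The 1/8 below pays for three halvings: in the lower
   bound on [N n], in [q], and in [Z_lower_tail]. *)
have d4 : expR (- (n%:R * delta)) <= 1 / 4.
  by near: n; apply: (cvgr_le _ (cvg_expR_decay delta0)).
have e8 : expR (- (n%:R * eta)) <= 1 / 8.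
  by near: n; apply: (cvgr_le _ (cvg_expR_decay eta0)).
pose q := expR (- (n%:R * (legendre phi b + b * eta))) / 2.
have q0 : 0 < q by rewrite divr_gt0// expR_gt0.
pose x := n%:R * (derive1 phi b - eta).
have hq i : (q%:E <= P [set w | (x <= S i n w)%R])%E.
  apply: le_trans (tail i n); rewrite lee_fin ler_wpM2l ?expR_ge0//.
  by have := half _ d4; rewrite div1r.
have low := Z_lower_tail N0 q0 hq.
have up := Z_upper_tail log_mgf_fin X_indep X_copies N n (n%:R * (l + eps))
  (ltW a0) a1.
have Nq : expR (n%:R * (k / 2)) / 4 <= (N n)%:R * q.
  apply: (@le_trans _ _ (expR (c * n%:R) / 2 * q)); last by rewrite ler_pM2r.
  rewrite /q mulrACA -invfM -expRD; have -> : 2 * 2 = 4 :> R by ring.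
  rewrite ler_wpM2r// ler_expR [c * _]mulrC -mulrN -mulrDr.
  by rewrite ler_pM2l.
have Nq0 : 0 < (N n)%:R * q by rewrite mulr_gt0// ltr0n.
have thr : expR (n%:R * (l - eps)) <= (N n)%:R * q / 2 * expR x.
  apply: (@le_trans _ _ (expR (c * n%:R) / 2 * q / 2 * expR x)); last first.
    apply: ler_wpM2r; first exact: expR_ge0.
    by apply: ler_wpM2r => //; apply: ler_wpM2r => //; exact: ltW.
  have -> : expR (c * n%:R) / 2 * q / 2 * expR x =
     expR (c * n%:R + - (n%:R * (legendre phi b + b * eta)) + x) / 8.
    by rewrite /q !expRD; field.
  set y := (X in expR X / 8); apply: (@le_trans _ _ (expR (y - n%:R * eta))).
    rewrite ler_expR /y /x [c * _]mulrC -mulrN -!mulrDr -mulrN -mulrDr.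
    by rewrite ler_pM2l.
  by rewrite expRD ler_wpM2l ?expR_ge0// -div1r.
have mln : measurable_fun setT (fun w => - `|n%:R^-1 * ln (Z n w) - l|).
  apply: measurableT_comp => //; apply: measurableT_comp => //.
  apply: measurable_funB => //; apply: measurable_funM => //.
  apply: measurableT_comp; first exact: measurable_ln.
  exact: measurable_Z.
set B := [set w | _].
have mB : measurable B.
  rewrite (_ : B = [set w | - `|n%:R^-1 * ln (Z n w) - l| < - eps]).
    exact: measurable_set_lt.
  by apply/seteqP; split => w; rewrite /B/= ltrN2.
set B1 := [set w | _] in up; set B2 := [set w | _] in low.
have mB2 : measurable B2 by apply: measurable_set_lt; exact: measurable_Z.
have mB1 : measurable B1 by apply: measurable_set_ge; exact: measurable_Z.
have sub : B `<=` B1 `|` B2.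
  move=> w; rewrite /B /B1 /B2 /= => hB; apply/orP; apply/negPn/negP.
  rewrite negb_or -ltNge -leNgt => /andP[z1 z2].
  have Z0 : 0 < Z n w by exact: Z_gt0.
  have y1 : ln (Z n w) < n%:R * (l + eps) by rewrite -ltr_expR lnK.
  have y2 : n%:R * (l - eps) <= ln (Z n w).
    by rewrite -ler_expR lnK//; exact: le_trans thr z2.
  move: hB; apply/negP; rewrite -leNgt ler_distl mulrC.
  by rewrite ler_pdivlMr// ler_pdivrMr// ![_ * n%:R]mulrC y2 ltW.
apply: (@le_trans _ _ (P (B1 `|` B2))).
  by apply: le_measure => //; rewrite inE//; exact: measurableU.
apply: (le_trans (measureU2 _ mB1 mB2)).
apply: (le_trans (leeD up low)); rewrite -EFinD lee_fin /u lerD//.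
  have -> : - (n%:R * (a * eps)) =
      c * n%:R + (n%:R * phi a - a * (n%:R * (l + eps))).
    have -> : a * (n%:R * (l + eps)) = n%:R * (a * l) + n%:R * (a * eps) by ring.
    by rewrite al; ring.
  by rewrite (expRD (c * n%:R)) [leRHS]mulrA ler_pM2r ?expR_gt0.
rewrite ler_pdivrMr// expRN.
have e0 := expR_gt0 (n%:R * (k / 2)).
rewrite mulrAC ler_pdivlMr//; exact: quarter.
Unshelve. all: by end_near. Qed.

End convergence.

Theorem theorem6 (R : realType)
    (d0 : measure_display) (T0 : measurableType d0) (P0 : probability T0 R)
    (X0 : {RV P0 >-> R})
    (hX0 : non_degenerate P0 X0)
    (hphi : forall t : R, 0 <= t -> log_mgf P0 X0 t \is a fin_num)
    (d : measure_display) (T : measurableType d) (P : probability T R)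
    (X : nat * nat -> {RV P >-> R})
    (hindep : mutually_independent P X)
    (hcopies : forall ij : nat * nat, same_distribution P P0 (X ij) X0)
    (N : nat -> nat) (c : R) (hc : 0 < c)
    (hN : expR (- (c * n%:R)) * (N n)%:R @[n --> \oo] --> (1 : R)) :
  (c_one P0 X0 <= c ->
     cvg_in_probability P (fun n w => n%:R^-1 * ln (Z P X N n w))
       (phi P0 X0 1 + c)) /\
  (c <= c_one P0 X0 ->
     cvg_in_probability P (fun n w => n%:R^-1 * ln (Z P X N n w))
       (rate_inv P0 X0 c)).
Proof.
have dphi := derivable_phi hphi.
have d2phi := phi_derive2 hphi hX0.
have c1E : legendre (phi P0 X0) 1 = c_one P0 X0 by rewrite /legendre mul1r.
split=> hc1.
  (* At [a = 1] both expressions required of the limit reduce to [phi P0 X0 1 + c]. *)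
  apply: (Z_cvg_in_probability hphi hX0 hindep hcopies hN (a := 1)) => //.
  - by rewrite c1E.
  - by rewrite mul1r.
  - by rewrite /legendre mul1r; ring.
rewrite -c1E in hc1.
have [a [a0 a1 ga]] :=
  legendre_onto dphi d2phi (cvg_phi_at0 hphi) hc hc1.
(* With [legendre] at [a] equal to [c], the limit is phi'(a), and both required identities restate
   the definition of [legendre]. *)
rewrite -ga (rate_invE hphi hX0 a0).
apply: (Z_cvg_in_probability hphi hX0 hindep hcopies hN (a := a)) => //.
- by rewrite ga.
- by rewrite -ga /legendre; ring.
- by rewrite ga; ring.
Qed.
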